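(* For $n\geq 1$ and $1\leq k\leq n$, \[op_{n,k}(123)=\sum_{d=n-k}^{n-1}\binom{d}{n-k}e_{n,d}.\]
   Context: Let $[n]=\{1,\dots,n\}$. An ordered partition of $[n]$ with $k$ blocks is a sequence $B_1/B_2/\cdots/B_k$ of nonempty pairwise disjoint subsets of $[n]$ whose union is $[n]$. An ordered partition $B_1/\cdots/B_k$ contains the pattern $123$ if there are indices $i_1<i_2<i_3$ and elements $b_j\in B_{i_j}$ with $b_1<b_2<b_3$; otherwise it avoids $123$. $op_{n,k}(123)$ denotes the number of $123$-avoiding ordered partitions of $[n]$ with $k$ blocks. $e_{n,d}$ denotes the number of permutations $\sigma=\sigma_1\cdots\sigma_n$ of $[n]$ having no subsequence $\sigma_a\sigma_b\sigma_c$ ($a<b<c$) with $\sigma_a<\sigma_b<\sigma_c$ and having exactly $d$ descents, i.e. $|\{i:\sigma_i>\sigma_{i+1}\}|=d$. *)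

(* Defs.v *)
From mathcomp Require Import all_boot all_fingroup.

Set Implicit Arguments.
Unset Strict Implicit.
Unset Printing Implicit Defensive.

(* The ground set [n] = {1, ..., n} is represented by 'I_n = {0, ..., n - 1};
   every notion below depends only on the order of its elements. *)

Definition is_ordered_partition (n k : nat) (B : {ffun 'I_k -> {set 'I_n}}) : bool :=
  [&& [forall i, B i != set0],
      [forall i, forall j, (i != j) ==> [disjoint B i & B j]]
    & \bigcup_(i < k) B i == [set: 'I_n]].

Definition op_contains123 (n k : nat) (B : {ffun 'I_k -> {set 'I_n}}) : bool :=
  [exists i1 : 'I_k, exists i2 : 'I_k, exists i3 : 'I_k,
   exists b1 : 'I_n, exists b2 : 'I_n, exists b3 : 'I_n,
     [&& i1 < i2, i2 < i3, b1 \in B i1, b2 \in B i2, b3 \in B i3,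
         b1 < b2 & b2 < b3]].

Definition op123 (n k : nat) : nat :=
  #|[set B : {ffun 'I_k -> {set 'I_n}} |
      is_ordered_partition B && ~~ op_contains123 B]|.

Definition perm_contains123 (n : nat) (s : 'S_n) : bool :=
  [exists a : 'I_n, exists b : 'I_n, exists c : 'I_n,
     [&& a < b, b < c, s a < s b & s b < s c]].

(* The final position is never a descent, since it has no successor in 'I_n. *)
Definition descents (n : nat) (s : 'S_n) : {set 'I_n} :=
  [set i : 'I_n | [exists j : 'I_n, (j == i.+1 :> nat) && (s j < s i)]].

Definition e123 (n d : nat) : nat :=
  #|[set s : 'S_n | ~~ perm_contains123 s && (#|descents s| == d)]|.

(* Main.v *)
Require Import Defs.
From mathcomp Require Import all_boot all_fingroup.
From mathcomp Require Import zify.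

Set Implicit Arguments.
Unset Strict Implicit.
Unset Printing Implicit Defensive.

(** Listing every block in decreasing order turns a 123-avoiding ordered
    partition into a permutation [s], together with the set [D] of those
    descents of [s] that lie inside a block.  A 123-pattern uses at most one
    entry of each block, so [s] avoids 123 as well, and [#|D| = n - k].
    Conversely any [n - k] descents of a 123-avoiding [s] may be chosen as the
    places where no bar is inserted.  An ordered partition is encoded by the
    surjection sending an element to the index of its block. *)

(** * The unique permutation listing a strict total order *)

Section SortingPermutation.

Variables (n : nat) (r : rel 'I_n).
Hypotheses (r_irr : irreflexive r) (r_trans : transitive r).
Hypothesis r_total : forall x y, x != y -> r x y || r y x.

Definition sorts (s : 'S_n) : bool :=
  [forall p : 'I_n, forall q : 'I_n, (p < q) ==> r (s p) (s q)].

Lemma sortsP (s : 'S_n) :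
  reflect (forall p q : 'I_n, p < q -> r (s p) (s q)) (sorts s).
Proof.
apply: (iffP forallP) => [H p q lt_pq | H p].
  by move/forallP/(_ q)/implyP: (H p); apply.
by apply/forallP => q; apply/implyP => /H.
Qed.

Lemma card_below_lt (x : 'I_n) : #|[set y | r y x]| < n.
Proof.
rewrite -[X in _ < X]card_ord -cardsT; apply: proper_card.
by apply/properP; split; [apply: subsetT | exists x; rewrite ?inE ?r_irr].
Qed.

Definition below_rank (x : 'I_n) : 'I_n := Ordinal (card_below_lt x).

Lemma below_rank_mono x y : r x y -> below_rank x < below_rank y.
Proof.
move=> rxy; apply: proper_card; apply/properP; split.
  by apply/subsetP => z; rewrite !inE => /r_trans; apply.
by exists x; rewrite !inE ?r_irr.
Qed.

Lemma below_rank_inj : injective below_rank.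
Proof.
move=> x y exy; apply/eqP; apply: contraT => /r_total /orP[] /below_rank_mono;
  by rewrite exy ltnn.
Qed.

Lemma sorts_rank_inv : sorts (perm below_rank_inj)^-1.
Proof.
apply/sortsP => p q lt_pq; set u := perm _.
set x := (u^-1)%g p; set y := (u^-1)%g q.
have ep : p = below_rank x by rewrite -(permE below_rank_inj) permKV.
have eq_ : q = below_rank y by rewrite -(permE below_rank_inj) permKV.
have nxy : x != y.
  by apply/eqP => exy; move: lt_pq; rewrite ep eq_ exy ltnn.
case/orP: (r_total nxy) => // /below_rank_mono.
by rewrite -ep -eq_ ltnNge ltnW.
Qed.

(** The elements preceding [s p] are exactly the images under [s] of the positions before [p]. This
    forces [s] to be the inverse of the rank. *)
Lemma sorts_rank (s : 'S_n) (p : 'I_n) : sorts s -> below_rank (s p) = p.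
Proof.
move/sortsP => H; apply: val_inj => /=.
have -> : [set y | r y (s p)] = s @: [set q : 'I_n | q < p].
  apply/setP => y; rewrite inE; apply/idP/imsetP => [ry | [q]].
    exists ((s^-1)%g y); rewrite ?permKV // inE.
    case: (ltngtP ((s^-1)%g y) p) => // [lt_py | epy].
      by move/H: lt_py; rewrite permKV => /(r_trans ry); rewrite r_irr.
    by move: ry; rewrite -(val_inj epy) permKV r_irr.
  by rewrite inE => /H ? ->.
rewrite card_imset; last exact: perm_inj.
rewrite cardsE -sum1_card (eq_bigl (fun q : 'I_n => q < p)) //.
by rewrite -(big_ord_widen n (fun=> 1)) ?sum1_card ?card_ord // ltnW.
Qed.

(** Existence and uniqueness take the form of a cardinal, so that a term [1] can later become a sum
    over sorting permutations. *)
Lemma card_sorts : #|[set s | sorts s]| = 1.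
Proof.
apply/eqP/cards1P; exists (perm below_rank_inj)^-1%g.
apply/setP => s; rewrite !inE; apply/idP/eqP => [ss | ->]; last first.
  exact: sorts_rank_inv.
apply/permP => p; apply: (@perm_inj _ (perm below_rank_inj)).
by rewrite permKV permE sorts_rank.
Qed.

End SortingPermutation.

(** * Ordered partitions as surjections onto block indices *)

Definition is_surj (n k : nat) (f : {ffun 'I_n -> 'I_k}) : bool :=
  [forall j, exists x, f x == j].

Lemma is_surjP (n k : nat) (f : {ffun 'I_n -> 'I_k}) :
  reflect (forall j, exists x, f x = j) (is_surj f).
Proof.
apply: (iffP forallP) => H j.
  by case/existsP: (H j) => x /eqP; exists x.
by case: (H j) => x <-; apply/existsP; exists x.
Qed.

Definition fun_contains123 (n k : nat) (f : {ffun 'I_n -> 'I_k}) : bool :=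
  [exists x : 'I_n, exists y : 'I_n, exists z : 'I_n,
     [&& x < y, y < z, f x < f y & f y < f z]].

Lemma fun_contains123P (n k : nat) (f : {ffun 'I_n -> 'I_k}) :
  reflect (exists x y z : 'I_n, [/\ x < y, y < z, f x < f y & f y < f z])
          (fun_contains123 f).
Proof.
apply: (iffP existsP) => -[x H]; exists x.
  by case/existsP: H => y /existsP[z /and4P[]]; exists y, z.
case: H => y [z [? ? ? ?]].
by apply/existsP; exists y; apply/existsP; exists z; apply/and4P.
Qed.

Lemma perm_contains123P (n : nat) (s : 'S_n) :
  reflect (exists a b c : 'I_n, [/\ a < b, b < c, s a < s b & s b < s c])
          (perm_contains123 s).
Proof.
apply: (iffP existsP) => -[x H]; exists x.
  by case/existsP: H => y /existsP[z /and4P[]]; exists y, z.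
case: H => y [z [? ? ? ?]].
by apply/existsP; exists y; apply/existsP; exists z; apply/and4P.
Qed.

Definition fibers (n k : nat) (f : {ffun 'I_n -> 'I_k}) :
  {ffun 'I_k -> {set 'I_n}} := [ffun j => [set x | f x == j]].

Lemma mem_fibers (n k : nat) (f : {ffun 'I_n -> 'I_k}) j x :
  (x \in fibers f j) = (f x == j).
Proof. by rewrite ffunE inE. Qed.

Lemma fibers_inj (n k : nat) : injective (@fibers n k).
Proof.
move=> f g efg; apply/ffunP => x; apply/eqP.
by rewrite eq_sym -mem_fibers -efg mem_fibers.
Qed.

Lemma op_contains123_fibers (n k : nat) (f : {ffun 'I_n -> 'I_k}) :
  op_contains123 (fibers f) = fun_contains123 f.
Proof.
apply/idP/fun_contains123P => [|[x [y [z [? ? ? ?]]]]].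
  case/existsP=> i1 /existsP[i2 /existsP[i3 /existsP[x /existsP[y /existsP[z]]]]].
  rewrite !mem_fibers.
  case/and5P=> ? ? /eqP e1 /eqP e2 /and3P[/eqP e3 ? ?].
  by exists x, y, z; rewrite e1 e2 e3.
apply/existsP; exists (f x); apply/existsP; exists (f y).
apply/existsP; exists (f z); apply/existsP; exists x.
apply/existsP; exists y; apply/existsP; exists z.
by rewrite !mem_fibers !eqxx; apply/and5P; split=> //; apply/and3P.
Qed.

Lemma is_ordered_partition_fibers (n k : nat) (f : {ffun 'I_n -> 'I_k}) :
  is_ordered_partition (fibers f) = is_surj f.
Proof.
apply/and3P/is_surjP => [[/forallP ne _ _] j | surj].
  by case/set0Pn: (ne j) => x; rewrite mem_fibers => /eqP; exists x.
split.
- apply/forallP => j; apply/set0Pn; case: (surj j) => x fx.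
  by exists x; rewrite mem_fibers fx.
- apply/forallP => i; apply/forallP => j; apply/implyP => nij.
  apply/pred0P => x /=; rewrite !mem_fibers; apply/negP => /andP[/eqP fi /eqP fj].
  by rewrite -fi -fj eqxx in nij.
- apply/eqP/setP => x; rewrite inE; apply/bigcupP.
  by exists (f x); rewrite ?mem_fibers.
Qed.

Lemma ordered_partition_fibers (n k : nat) (B : {ffun 'I_k -> {set 'I_n}}) :
  is_ordered_partition B -> exists f, B = fibers f.
Proof.
case/and3P=> _ /forallP dis /eqP cov.
have ex x : exists j, x \in B j.
  have : x \in \bigcup_(i < k) B i by rewrite cov inE.
  by case/bigcupP=> j _; exists j.
exists [ffun x => xchoose (ex x)]; apply/ffunP => j; apply/setP => x.
rewrite mem_fibers ffunE; apply/idP/eqP => [xj | <-]; last exact: xchooseP (ex x).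
apply/eqP; apply: contraT => nj.
move/forallP/(_ j)/implyP/(_ nj)/pred0P/(_ x): (dis (xchoose (ex x))) => /=.
by rewrite xj (xchooseP (ex x)).
Qed.

Lemma op123_surj (n k : nat) :
  op123 n k = #|[set f : {ffun 'I_n -> 'I_k} | is_surj f & ~~ fun_contains123 f]|.
Proof.
rewrite -(card_imset _ (@fibers_inj n k)); apply: eq_card => B.
rewrite inE; apply/idP/imsetP => [/andP[opB avB] | [f]].
  case: (ordered_partition_fibers opB) => f eB; exists f => //.
  by rewrite inE -is_ordered_partition_fibers -op_contains123_fibers -eB opB.
by rewrite inE -is_ordered_partition_fibers -op_contains123_fibers => ? ->.
Qed.

(** * Reading the blocks from left to right, each one decreasingly *)

Definition block_prec (n k : nat) (f : {ffun 'I_n -> 'I_k}) : rel 'I_n :=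
  fun x y => (f x < f y) || (f x == f y) && (y < x).

Lemma block_prec_irr (n k : nat) (f : {ffun 'I_n -> 'I_k}) :
  irreflexive (block_prec f).
Proof. by move=> x; rewrite /block_prec !ltnn andbF. Qed.

Lemma block_prec_trans (n k : nat) (f : {ffun 'I_n -> 'I_k}) :
  transitive (block_prec f).
Proof. by move=> y x z; rewrite /block_prec -!val_eqE /=; lia. Qed.

Lemma block_prec_total (n k : nat) (f : {ffun 'I_n -> 'I_k}) x y :
  x != y -> block_prec f x y || block_prec f y x.
Proof. by rewrite /block_prec -!val_eqE /=; lia. Qed.

(** Strictly increasing block indices force increasing positions. Conversely, a larger entry at a
    later position cannot lie in the same block, since each block is listed decreasingly. *)
Lemma sorts_contains123 (n k : nat) (f : {ffun 'I_n -> 'I_k}) (s : 'S_n) :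
  sorts (block_prec f) s -> fun_contains123 f = perm_contains123 s.
Proof.
move/sortsP=> srt; apply/fun_contains123P/perm_contains123P.
  have lt_pos (x y : 'I_n) : f x < f y -> (s^-1)%g x < (s^-1)%g y.
    move=> lt_f; case: (ltngtP ((s^-1)%g x) ((s^-1)%g y)) => // [/srt | /val_inj].
      by rewrite !permKV /block_prec -val_eqE /=; lia.
    by move/perm_inj => exy; rewrite exy ltnn in lt_f.
  case=> x [y [z [xy yz fxy fyz]]].
  exists ((s^-1)%g x), ((s^-1)%g y), ((s^-1)%g z).
  by rewrite !permKV; split=> //; apply: lt_pos.
case=> a [b [c [ab bc sab sbc]]]; exists (s a), (s b), (s c).
move/srt: ab; move/srt: bc; rewrite /block_prec => bc ab.
by split=> //; move: ab bc; rewrite -!val_eqE /=; lia.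
Qed.

(** * Choosing the descents that lie inside blocks *)

Lemma descentsP (m : nat) (s : 'S_m.+1) (i : nat) : i <= m ->
  (inord i \in descents s) = (i < m) && (s (inord i.+1) < s (inord i)).
Proof.
move=> le_im; rewrite inE; apply/existsP/andP => [[j] | [lt_im lt_s]].
  rewrite inordK // => /andP[/eqP ej lt_s].
  by rewrite -ej inord_val -ltnS; split.
by exists (inord i.+1); rewrite lt_s !inordK ?eqxx.
Qed.

Section MergedDescents.

Variables (m k : nat) (s : 'S_m.+1).

(** With [D] the positions not followed by a bar, this counts the bars before position [p], which is
    the index of the block holding that position. *)
Definition nbars (D : {set 'I_m.+1}) (p : nat) : nat :=
  \sum_(0 <= i < p) (inord i \notin D).

Lemma nbarsS D p : nbars D p.+1 = nbars D p + (inord p \notin D).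
Proof. by rewrite /nbars big_nat_recr. Qed.

Lemma nbars_full D : nbars D m.+1 + #|D| = m.+1.
Proof.
rewrite -[X in _ = X]card_ord -(cardsC D) addnC; congr (_ + _).
rewrite /nbars big_mkord -sum1_card big_mkcond /=.
by rewrite [in RHS]big_mkcond /=; apply: eq_bigr => i _; rewrite inord_val inE; case: ifP.
Qed.

Lemma leq_nbars D p q : p <= q -> nbars D p <= nbars D q.
Proof.
elim: q => [|q IH]; first by rewrite leqn0 => /eqP->.
by rewrite leq_eqVlt => /orP[/eqP-> // | /IH]; rewrite nbarsS; lia.
Qed.

Lemma nbars_last (D : {set 'I_m.+1}) : D \subset descents s -> nbars D m + #|D| = m.
Proof.
move=> sD; have := nbars_full D; rewrite nbarsS.
have -> : inord m \notin D.
  by apply: contraTN isT => /(subsetP sD); rewrite descentsP // ltnn.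
lia.
Qed.

(** The count starts at 0 and each step adds at most 1, so no value is skipped. *)
Lemma nbars_onto D p j : j <= nbars D p -> exists2 q, q <= p & nbars D q = j.
Proof.
elim: p => [|p IH] lej.
  by exists 0 => //; move: lej; rewrite /nbars big_nil leqn0 => /eqP.
have [/IH[q leq eq_]|gtj] := leqP j (nbars D p).
  by exists q => //; apply: leqW.
by exists p.+1 => //; move: lej; rewrite nbarsS; lia.
Qed.

(** Equal counts mean that no bar separates the two positions, so all positions from [p] to [q - 1]
    are descents and their inequalities chain. *)
Lemma nbars_eq_decr (D : {set 'I_m.+1}) p q : D \subset descents s -> p < q -> q <= m ->
  nbars D p = nbars D q -> s (inord q) < s (inord p).
Proof.
move=> sD; elim: q => // q IH; rewrite ltnS => le_pq lt_qm.
rewrite nbarsS => e.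
have le := leq_nbars D le_pq.
have : inord q \in D by apply: contraT => nq; move: e; rewrite nq; lia.
move/(subsetP sD); rewrite (descentsP _ (ltnW lt_qm)) => /andP[_ lt_s].
move: le_pq; rewrite leq_eqVlt => /orP[/eqP-> // | lt_pq].
apply: ltn_trans lt_s _; apply: IH => //; first exact: ltnW.
by lia.
Qed.

(** Sends each entry to the block in which the bars put it. For [k <= m] and [D] in [merge_sets], at
    most [k] bars precede any position, so [inord] keeps the value. *)
Definition merged_fun (D : {set 'I_m.+1}) : {ffun 'I_m.+1 -> 'I_k.+1} :=
  [ffun x => inord (nbars D ((s^-1)%g x))].

Definition merge_sets : {set {set 'I_m.+1}} :=
  [set D : {set 'I_m.+1} | D \subset descents s & #|D| == m - k].

Hypothesis le_km : k <= m.

Lemma merged_funE D p : D \in merge_sets -> p <= m ->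
  merged_fun D (s (inord p)) = nbars D p :> nat.
Proof.
rewrite inE => /andP[sD /eqP cD] le_pm.
rewrite ffunE permK [in nbars _ _]inordK // inordK //.
have := leq_nbars D le_pm; have := nbars_last sD; lia.
Qed.

(** The increments of [nbars] reveal membership in [D] at every position below [m], and the last
    position, not being a descent, is never in [D]. *)
Lemma merged_fun_inj : {in merge_sets &, injective merged_fun}.
Proof.
move=> D E mD mE e.
have eN p : p <= m -> nbars D p = nbars E p.
  by move=> lp; rewrite -merged_funE // e merged_funE.
have nlast F : F \in merge_sets -> inord m \notin F.
  rewrite inE => /andP[sF _]; apply: contraTN isT => /(subsetP sF).
  by rewrite descentsP // ltnn.
apply/setP => i; rewrite -[i]inord_val.
have := ltn_ord i; rewrite ltnS leq_eqVlt => /orP[/eqP-> | lt_im].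
  by rewrite (negbTE (nlast _ mD)) (negbTE (nlast _ mE)).
have := eN _ lt_im; rewrite !nbarsS (eN _ (ltnW lt_im)).
by case: (_ \in D); case: (_ \in E) => //=; lia.
Qed.

Lemma merged_fun_surj D : D \in merge_sets -> is_surj (merged_fun D).
Proof.
move=> mD; apply/is_surjP => j.
have le_j : j <= nbars D m.
  move: mD; rewrite inE => /andP[sD /eqP cD].
  by have := nbars_last sD; have := ltn_ord j; lia.
have [q le_qm eq_] := nbars_onto le_j.
by exists (s (inord q)); apply: val_inj => /=; rewrite merged_funE.
Qed.

Lemma merged_fun_sorts D : D \in merge_sets -> sorts (block_prec (merged_fun D)) s.
Proof.
move=> mD; apply/sortsP => p q lt_pq.
have ep := merged_funE mD (ltn_ord p : p <= m).
have eq_ := merged_funE mD (ltn_ord q : q <= m).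
rewrite !inord_val in ep eq_; rewrite /block_prec -val_eqE /= ep eq_.
have := leq_nbars D (ltnW lt_pq); rewrite leq_eqVlt orbC.
case/orP=> [-> // | e]; rewrite e; apply/orP; right => /=.
rewrite -[X in _ < s X]inord_val -[X in s X < _]inord_val.
apply: (@nbars_eq_decr D) => //; last exact/eqP.
  by move: mD; rewrite inE => /andP[].
exact: (ltn_ord q).
Qed.

(** Recovers [D] from the surjection. The guard [p < m] matters: at the last position [inord p.+1]
    defaults to [ord0]. *)
Definition merged_of (f : {ffun 'I_m.+1 -> 'I_k.+1}) : {set 'I_m.+1} :=
  [set p : 'I_m.+1 | (p < m) && (f (s p) == f (s (inord p.+1)))].

(** Along [s], [f] is weakly increasing and misses no value, so it starts at 0 and grows by at most
    1 per step. Its value is thus the number of strict increases so far. *)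
Lemma nbars_merged_of f p : is_surj f -> sorts (block_prec f) s -> p <= m ->
  nbars (merged_of f) p = f (s (inord p)).
Proof.
move=> /is_surjP surj /sortsP srt.
have mono a b : a <= b -> b <= m -> f (s (inord a)) <= f (s (inord b)).
  move=> ab bm; move: ab; rewrite leq_eqVlt => /orP[/eqP-> // | ab].
  have := srt (inord a) (inord b); rewrite !inordK ?ltnS //; last lia.
  by move/(_ ab); rewrite /block_prec -val_eqE /=; lia.
have at_pos j : exists2 q, q <= m & f (s (inord q)) = j.
  case: (surj j) => x fx; exists ((s^-1)%g x : nat); first by rewrite -ltnS.
  by rewrite inord_val permKV.
elim: p => [|p IH] le_pm.
  (* The value 0 is reached somewhere, and monotonicity then forces it at position 0. *)
  have [q le_qm e] := at_pos ord0.
  by have := mono 0 q isT le_qm; rewrite e /nbars big_nil /=; lia.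
rewrite nbarsS (IH (ltnW le_pm)) inE inordK; last exact: leqW.
rewrite le_pm /=.
have le1 := mono p p.+1 (leqnSn p) le_pm.
have [-> | ne] := eqVneq; first by rewrite addn0.
have [lt|] := ltnP (f (s (inord p))).+1 (f (s (inord p.+1))); last first.
  by move: ne; rewrite -val_eqE /=; lia.
(* A jump by two or more would skip this value. Surjectivity places it at some [q], but monotonicity
   excludes both [q <= p] and [p < q]. *)
have lt_k : (f (s (inord p))).+1 < k.+1 by apply: ltn_trans lt (ltn_ord _).
have [q le_qm e] := at_pos (Ordinal lt_k).
have [le_qp | lt_pq] := leqP q p.
  by have := mono q p le_qp (ltnW le_pm); rewrite e /= ltnn.
by have := mono p.+1 q lt_pq le_qm; rewrite e /=; lia.
Qed.

Lemma merged_ofP f : is_surj f -> sorts (block_prec f) s ->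
  merged_of f \in merge_sets /\ f = merged_fun (merged_of f).
Proof.
move=> surj srt.
have sD : merged_of f \subset descents s.
  apply/subsetP => p; rewrite inE => /andP[lt_pm /eqP e].
  rewrite -(inord_val p) (descentsP _ (ltnW lt_pm)) lt_pm inord_val /=.
  (* Neighbouring positions in one block are listed decreasingly, hence form a descent. *)
  move/sortsP: srt => /(_ p (inord p.+1)); rewrite inordK // ltnSn => /(_ isT).
  by rewrite /block_prec e ltnn eqxx.
(* The value [k] is attained, and the last position carries the largest value. *)
have last_k : f (s (inord m)) = k :> nat.
  have /is_surjP/(_ ord_max)[x fx] := surj.
  have lx : (s^-1)%g x <= m by rewrite -ltnS.
  have := leq_nbars (merged_of f) lx.
  rewrite !nbars_merged_of // inord_val permKV fx /=.
  by have := ltn_ord (f (s (inord m))); lia.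
have mD : merged_of f \in merge_sets.
  rewrite inE sD /=; have := nbars_last sD.
  rewrite nbars_merged_of // last_k => e.
  by apply/eqP; apply: (canRL (addKn k)) e.
split=> //; apply/ffunP => x; apply: val_inj => /=.
have lx : (s^-1)%g x <= m by rewrite -ltnS.
by rewrite -(permKV s x) -(inord_val ((s^-1)%g x)) merged_funE // nbars_merged_of.
Qed.

(** For fixed [s], [merged_fun] is a bijection from [merge_sets] onto these surjections. *)
Lemma card_surj_sorts :
  #|[set f : {ffun 'I_m.+1 -> 'I_k.+1} | is_surj f & sorts (block_prec f) s]|
  = 'C(#|descents s|, m - k).
Proof.
rewrite -cards_draws -/merge_sets -(card_in_imset merged_fun_inj).
apply: eq_card => f; rewrite inE; apply/andP/imsetP => [[surj srt] | [D mD ->]].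
  by have [mD ef] := merged_ofP surj srt; exists (merged_of f).
by split; [apply: merged_fun_surj | apply: merged_fun_sorts].
Qed.

End MergedDescents.

(** * Double counting and grouping by the number of descents *)

Lemma card_descents_lt (m : nat) (s : 'S_m.+1) : #|descents s| < m.+1.
Proof. by have := nbars_last (subxx (descents s)); lia. Qed.

(** Double count of the pairs [(f, s)] in which [s] sorts [f]: each [f] has exactly one [s], and
    [card_surj_sorts] counts the [f] for each [s]. *)
Lemma op123_sum_perm (m k : nat) : k <= m ->
  op123 m.+1 k.+1
  = \sum_(s : 'S_m.+1 | ~~ perm_contains123 s) 'C(#|descents s|, m - k).
Proof.
move=> le_km; rewrite op123_surj -sum1_card.
under eq_bigr => f _ do rewrite -(card_sorts (@block_prec_irr _ _ f)
  (@block_prec_trans _ _ f) (@block_prec_total _ _ f)) -sum1_card.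
rewrite (exchange_big_dep (fun s => ~~ perm_contains123 s)) /=; last first.
  move=> f s; rewrite !inE => /andP[_ avf] srt.
  by rewrite -(sorts_contains123 srt).
apply: eq_bigr => s avs; rewrite -card_surj_sorts // -sum1_card.
apply: eq_bigl => f; rewrite !inE.
case srt: (sorts _ s); rewrite ?andbF // !andbT.
by rewrite (sorts_contains123 srt) avs andbT.
Qed.

Theorem theorem2p2 (n k : nat) (hn : 1 <= n) (hk1 : 1 <= k) (hkn : k <= n) :
  op123 n k = \sum_(n - k <= d < n) 'C(d, n - k) * e123 n d.
Proof.
case: n hn hkn => // m _; case: k hk1 => // k _; rewrite ltnS => le_km.
rewrite op123_sum_perm // subSS.
(* The terms with [d < m - k] have a zero binomial, so the sum may start at 0. *)
transitivity (\sum_(0 <= d < m.+1) 'C(d, m - k) * e123 m.+1 d); last first.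
  rewrite (@big_cat_nat _ _ _ (m - k)) //=; last by lia.
  rewrite big_nat_cond big1 ?add0n // => d /andP[/andP[_ lt_d] _].
  by rewrite bin_small.
rewrite big_mkord.
(* Permutations are grouped by their number of descents, which [card_descents_lt] makes an index in
   ['I_m.+1]. *)
rewrite (partition_big (fun s => Ordinal (card_descents_lt s)) xpredT) //=.
apply: eq_bigr => d _; rewrite /e123 mulnC -sum_nat_const.
apply: eq_big => [s | s /andP[_ /eqP<-]] //.
by rewrite inE -val_eqE.
Qed.
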